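(* Let $\tau_g = g(\mathbb{E}\{Y(1)\}) - g(\mathbb{E}\{Y(0)\})$ be the defined experiment effect. Suppose $\theta\in\mathbb{R}$ and $\gamma_1,\gamma_2\in\mathbb{R}$ with $\gamma_1+\gamma_2=1$. Consider the estimator $$\hat\tau_g = g(\bar Y_t) - g(\bar Y_c),$$ which is asymptotically unbiased in general (and unbiased if $g(x)=x$ for all $x\in\mathbb{R}$). With imputation functions $h(X_i,W_i)$ and $f(X_i)$, consider the adjusted estimators $$\text{(a)}\quad \hat\tau_{adj}(w) = \hat\tau_g - \theta\big(g(\bar h_t(w)) - g(\bar h_c(w))\big),\quad w=0,1,$$ $$\text{(b)}\quad \hat\tau_{adj} = \hat\tau_g - \theta\big(g(\bar f_t) - g(\bar f_c)\big),$$ $$\text{(c)}\quad \hat\tau_{adj} = \gamma_1\hat\tau_g + \gamma_2\big(g(\bar h_c(1)) - g(\bar h_t(0))\big),$$ $$\text{(d)}\quad \hat\tau_{adj} = \gamma_1\big(g(\bar Y_t) - g(\bar h_c(0))\big) + \gamma_2\big(g(\bar h_t(1)) - g(\bar Y_c)\big).$$ Then: (a) The estimator $\hat\tau_{adj}(w)$ in (a) is asymptotically unbiased if $\mathbb{E}\{g(\bar h_t(w))\}\to\mathbb{E}\{g(\bar h_c(w))\}$, which is also true if $\mathbb{E}\{\bar h_t(w)\}\to\mathbb{E}\{\bar h_c(w)\}$. (b) The estimator $\hat\tau_{adj}$ in (b) is asymptotically unbiased if $\mathbb{E}\{g(\bar f_t)\}\to\mathbb{E}\{g(\bar f_c)\}$,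 which is also true if $\mathbb{E}\{\bar f_t\}\to\mathbb{E}\{\bar f_c\}$. (c) The estimator $\hat\tau_{adj}$ in (c) is asymptotically unbiased if $\mathbb{E}\{g(\bar h_c(1)) - g(\bar h_t(0))\}\to\tau_g$. (d) The estimator $\hat\tau_{adj}$ in (d) is asymptotically unbiased if $\mathbb{E}\{g(\bar Y_t) - g(\bar h_c(0))\}\to\tau_g$ and $\mathbb{E}\{g(\bar h_t(1)) - g(\bar Y_c)\}\to\tau_g$.
   Context: A randomized experiment has a treatment arm $t$ with $N_t$ units and a control arm $c$ with $N_c$ units. $Y(1)$ and $Y(0)$ denote the response of a unit under treatment and control respectively; $Y_i$ is the observed response of unit $i$, $W_i\in\{0,1\}$ is its arm (1 for treatment, 0 for control), and $X_i\in\mathbb{R}^p$ is a vector of $p$ predictive variables of unit $i$. $g$ is a real-valued differentiable function (with domain being the support of the variables involved). $h:\mathbb{R}^p\times\{0,1\}\to\mathbb{R}$ is a function of the predictors and the experiment arm, and $f:\mathbb{R}^p\to\mathbb{R}$ is a function of the predictors only; no particular properties of $h,f$ are required (in practice they are prediction functions for the response). Notation, for $w=0,1$: $$\bar Y_t = \tfrac1{N_t}\sum_{i\in t}Y_i,\quad \bar Y_c=\tfrac1{N_c}\sum_{i\in c}Y_i,\quad \bar h_t(w)=\tfrac1{N_t}\sum_{i\in t}h(X_i,w),\quad \bar h_c(w)=\tfrac1{N_c}\sum_{i\in c}h(X_i,w),$$ $$\bar f_t=\tfrac1{N_t}\sum_{i\in t}f(X_i),\quad \bar f_c=\tfrac1{N_c}\sum_{i\in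 c}f(X_i).$$ Limits are as the sample sizes $N_t,N_c$ grow to infinity; $\mathbb{E}\{A\}\to\mathbb{E}\{B\}$, for two sample averages or functions of them, means that the difference $\mathbb{E}\{A\}-\mathbb{E}\{B\}$ tends to 0. ''Asymptotically unbiased'' (respectively ''unbiased'') means that the expectation of the estimator tends to (respectively equals) $\tau_g$.
   Formalization: Units in each arm are taken i.i.d.; g(Ȳ_t), g(Ȳ_c) are assumed asymptotically uniformly integrable throughout, as are g of the h- and f-averages in the ''also true if'' claims of (a), (b); otherwise g(x)=exp(x⁴) with normal data gives infinite expectations. *)

(* Defs.v *)
From HB Require Import structures.
From mathcomp Require Export all_boot all_order all_algebra finmap.
From mathcomp Require Export all_classical all_reals all_analysis.
Set Implicit Arguments.
Unset Strict Implicit.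
Unset Printing Implicit Defensive.
Import Order.TTheory GRing.Theory Num.Theory.
Import numFieldNormedType.Exports.
Local Open Scope classical_set_scope.
Local Open Scope ring_scope.

(* Differentiability of a function whose domain is D: the difference quotient
   at x is taken over the points of D only, so it is one-sided at an endpoint
   of D and the values of g outside D play no role. *)
Definition differentiable_on (R : realType) (D : set R) (g : R -> R) : Prop :=
  forall x, D x ->
    exists l : R, (g y - g x) / (y - x) @[y --> within D x^'] --> l.

Section sampling.
Context {d d' : measure_display} {T : measurableType d} {S : measurableType d'}.
Context {R : realType} (P : probability T R).

Definition same_law (Z Z' : T -> S) : Prop :=
  forall A, measurable A -> P (Z @^-1` A) = P (Z' @^-1` A).

Definition mutually_independent (Z : nat -> T -> S) : Prop :=
  forall (J : {fset nat}) (A : nat -> set S), (forall i, measurable (A i)) ->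
    P (\bigcap_(i in [set` J]) (Z i @^-1` A i))
    = (\prod_(i <- J) P (Z i @^-1` A i))%E.

Definition iid (Z : nat -> T -> S) : Prop :=
  mutually_independent Z /\ forall i j, same_law (Z i) (Z j).

End sampling.

(* lim_(M -> oo) limsup_k E[ |U_k| ; |U_k| > M ] = 0 (van der Vaart, Asymptotic
   Statistics, section 2.5). *)
Definition asymptotically_uniformly_integrable (d : measure_display)
    (T : measurableType d) (R : realType) (P : probability T R)
    (U : nat -> T -> R) : Prop :=
  forall e : R, 0 < e -> exists M : R, \forall k \near \oo,
    (\int[P]_(x in [set x | (M < `|U k x|)%R]) (`|U k x|)%:E <= e%:E)%E.

Definition average (T : Type) (R : realType) (u : nat -> T -> R) (n : nat) :
  T -> R := fun x => (\sum_(i < n) u i x) / n%:R.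

(* A finite limit in \bar R forces 'E_P[est k] to be finite, hence est k to be
   integrable when it is measurable, for all large k. *)
Definition asymptotically_unbiased (d : measure_display)
    (T : measurableType d) (R : realType) (P : probability T R)
    (est : nat -> T -> R) (tau : R) : Prop :=
  'E_P[est k]%E @[k --> \oo] --> tau%:E.

(* The convergence E{A} -> E{B} of two sample statistics; as above, it entails
   that both expectations are finite for all large k. *)
Definition expectations_merge (d : measure_display)
    (T : measurableType d) (R : realType) (P : probability T R)
    (A B : nat -> T -> R) : Prop :=
  ('E_P[A k] - 'E_P[B k])%E @[k --> \oo] --> 0%E.

(* Main.v *)
From mathcomp Require Import ring lra measurable_realfun.
Require Import Defs.
Set Implicit Arguments.
Unset Strict Implicit.
Unset Printing Implicit Defensive.
Import Order.TTheory GRing.Theory Num.Theory.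
Import numFieldNormedType.Exports.
Local Open Scope classical_set_scope.
Local Open Scope ring_scope.

(** The averages converge in mean by the L^1 law of large numbers (truncation,
    then the variance bound for the truncated variables).  The common mean [m]
    lies in the interval [D], where [g] is continuous, so [g] of the average
    tends to [g m] in probability, and uniform integrability upgrades this to
    convergence of the expectations.  In (a) and (b) the predictions are not
    assumed integrable: the hypothesis that the expectations of the averages
    merge forces some average to have a finite expectation, and an i.i.d. sum
    can be integrable only if each of its terms is.  The merging of constant
    sequences then says that both arms have the same mean [m].  The rest is
    linearity of the expectation. *)

(** * Independence and equality in law *)

Section same_law_theory.
Context {d d' : measure_display} {T : measurableType d} {S : measurableType d'}.
Context {R : realType} (P : probability T R).

Lemma same_law_sym (Z Z' : T -> S) : same_law P Z Z' -> same_law P Z' Z.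
Proof. by move=> ZZ' A mA; rewrite ZZ'. Qed.

Lemma preimage_comp_measurable d'' (S' : measurableType d'') (phi : S -> S') A :
  measurable_fun setT phi -> measurable A -> measurable (phi @^-1` A).
Proof. by move=> mphi mA; rewrite -[_ @^-1` _]setTI; exact: mphi. Qed.

Lemma same_law_comp d'' (S' : measurableType d'') (phi : S -> S')
    (Z Z' : T -> S) :
  measurable_fun setT phi -> same_law P Z Z' ->
  same_law P (phi \o Z) (phi \o Z').
Proof.
by move=> mphi ZZ' A mA; exact: ZZ' (preimage_comp_measurable mphi mA).
Qed.

Lemma iid_comp d'' (S' : measurableType d'') (phi : S -> S')
    (W : nat -> T -> S) :
  measurable_fun setT phi -> iid P W -> iid P (fun i => phi \o W i).
Proof.
move=> mphi [indW lawW]; split => [J A mA|i j]; last exact: same_law_comp.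
exact: (indW J (fun i => phi @^-1` A i)
  (fun i => preimage_comp_measurable mphi (mA i))).
Qed.

(** Both sides are integrals of [phi] against the pushforward of [P], and equality in law says that
    the two pushforwards agree on measurable sets. *)
Lemma same_law_ge0_integral (Z Z' : T -> S) (phi : S -> \bar R) :
  measurable_fun setT Z -> measurable_fun setT Z' ->
  measurable_fun setT phi -> (forall y, 0 <= phi y)%E ->
  same_law P Z Z' -> (\int[P]_x phi (Z x) = \int[P]_x phi (Z' x))%E.
Proof.
move=> mZ mZ' mphi phi0 ZZ'.
pose X : {mfun T >-> S} := mfun_Sub (mem_set mZ).
pose X' : {mfun T >-> S} := mfun_Sub (mem_set mZ').
transitivity (\int[distribution P X]_y phi y)%E.
  by rewrite ge0_integral_distribution.
rewrite -[RHS](@ge0_integral_distribution _ _ _ _ _ P X')//.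
by apply: eq_measure_integral => A mA _; exact: ZZ'.
Qed.

End same_law_theory.

Section same_law_real.
Context {d : measure_display} {T : measurableType d}.
Context {R : realType} (P : probability T R).
Implicit Types Z : T -> R.

Lemma same_law_integrable Z Z' :
  measurable_fun setT Z -> measurable_fun setT Z' -> same_law P Z Z' ->
  P.-integrable setT (EFin \o Z) -> P.-integrable setT (EFin \o Z').
Proof.
move=> mZ mZ' ZZ' /integrableP[_ iZ]; apply/integrableP; split.
  exact/measurable_EFinP.
rewrite -(@same_law_ge0_integral _ _ _ _ _ _ Z Z' (fun y => `|y%:E|%E))//.
apply/measurable_EFinP; exact: normr_measurable.
Qed.

(** Positive and negative parts are nonnegative functions of the variable, so the previous transfer
    applies to each; integrability is therefore not assumed. *)
Lemma same_law_integral Z Z' :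
  measurable_fun setT Z -> measurable_fun setT Z' -> same_law P Z Z' ->
  (\int[P]_x (Z x)%:E = \int[P]_x (Z' x)%:E)%E.
Proof.
move=> mZ mZ' ZZ'; rewrite integralE [RHS]integralE; congr (_ - _)%E.
  under eq_integral do rewrite funeposE.
  under [RHS]eq_integral do rewrite funeposE.
  refine (@same_law_ge0_integral _ _ _ _ _ P Z Z'
    (fun r : R => maxe r%:E 0)%E mZ mZ' _ _ ZZ').
    by apply: measurable_maxe => //; exact/measurable_EFinP.
  by move=> y; rewrite le_max lexx orbT.
under eq_integral do rewrite funenegE.
under [RHS]eq_integral do rewrite funenegE.
refine (@same_law_ge0_integral _ _ _ _ _ P Z Z'
  (fun r : R => maxe (- r%:E) 0)%E mZ mZ' _ _ ZZ').
  by apply: measurable_maxe => //; exact/measurableT_comp/measurable_EFinP.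
by move=> y; rewrite le_max lexx orbT.
Qed.

Lemma same_law_Rintegral Z Z' :
  measurable_fun setT Z -> measurable_fun setT Z' -> same_law P Z Z' ->
  \int[P]_x Z x = \int[P]_x Z' x.
Proof. by move=> mZ mZ' ZZ'; congr fine; exact: same_law_integral. Qed.
End same_law_real.

(** * Products of independent random variables *)

Section independence.
Context {d : measure_display} {T : measurableType d}.
Context {R : realType} (P : probability T R).

(** Mutual independence is applied to the enlarged index set with the events [C], equal to [A] at
    [i] and to [B] elsewhere; the factor at [i] then splits off the product. *)
Lemma mutually_independent_bigcap d' (S : measurableType d')
    (Z : nat -> T -> S) (i : nat) (J : {fset nat}) (A B : set S) :
  mutually_independent P Z -> i \notin J -> measurable A -> measurable B ->
  P (Z i @^-1` A `&` \bigcap_(j in [set` J]) (Z j @^-1` B)) =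
  (P (Z i @^-1` A) * P (\bigcap_(j in [set` J]) (Z j @^-1` B)))%E.
Proof.
move=> indZ iJ mA mB; pose C k := if k == i then A else B.
have mC k : measurable (C k) by rewrite /C; case: ifP.
have CJ j : j \in J -> C j = B.
  by rewrite /C; case: eqP => // -> ji; rewrite ji in iJ.
have -> : \bigcap_(j in [set` J]) (Z j @^-1` B) =
          \bigcap_(j in [set` J]) (Z j @^-1` C j).
  by apply: eq_bigcapr => j /= jJ; rewrite CJ.
have -> : Z i @^-1` A = Z i @^-1` C i by rewrite /C eqxx.
have := indZ (i |` J)%fset C mC.
rewrite big_fsetU1//= -indZ// => <-; congr (P _).
apply/seteqP; split => [x [xi xJ] j /=|x xJ].
  by rewrite in_fset1U => /orP[/eqP ->//|]; exact: xJ.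
split; first by apply: xJ; rewrite /= in_fset1U eqxx.
by move=> j jJ; apply: xJ; rewrite /= in_fset1U jJ orbT.
Qed.

(** Independence on rectangles identifies the joint law with the product of the marginal laws, by
    uniqueness of the product measure; Tonelli then separates the factors. *)
Lemma ge0_integral_independentM (X Y : T -> R) :
  measurable_fun setT X -> measurable_fun setT Y ->
  (forall A B, measurable A -> measurable B ->
    P (X @^-1` A `&` Y @^-1` B) = (P (X @^-1` A) * P (Y @^-1` B))%E) ->
  (\int[P]_x `|X x * Y x|%:E =
   (\int[P]_x `|X x|%:E) * (\int[P]_x `|Y x|%:E))%E.
Proof.
move=> mX mY indXY.
pose X' : {mfun T >-> R} := mfun_Sub (mem_set mX).
pose Y' : {mfun T >-> R} := mfun_Sub (mem_set mY).
have mXY : measurable_fun setT (fun x => (X x, Y x)).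
  exact: measurable_fun_pair.
pose XY : {mfun T >-> (R * R)%type} := mfun_Sub (mem_set mXY).
pose f (z : R * R) : \bar R := `|z.1 * z.2|%:E.
have mf : measurable_fun setT f.
  apply/measurable_EFinP; apply: measurableT_comp => //.
  by apply: measurable_funM; [exact: measurable_fst|exact: measurable_snd].
have mabs : measurable_fun setT (fun r : R => `|r|%:E).
  apply/measurable_EFinP; exact: normr_measurable.
rewrite -(@ge0_integral_distribution _ _ _ _ _ P XY f)//; last first.
  by move=> z; rewrite lee_fin.
rewrite -(@eq_measure_integral _ _ _ _ _
    (distribution P X' \x distribution P Y')%E); last first.
  by move=> C mC _; apply: product_measure_unique.
rewrite fubini_tonelli1//; last by move=> z; rewrite lee_fin.
rewrite /fubini_F /f /=.
under eq_integral => x _.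
  under eq_integral do rewrite normrM EFinM.
  rewrite ge0_integralZl//.
  over.
rewrite ge0_integralZr//; last exact: integral_ge0.
by rewrite !ge0_integral_distribution.
Qed.

Lemma independentM_integrable (X Y : T -> R) :
  measurable_fun setT X -> measurable_fun setT Y ->
  (forall A B, measurable A -> measurable B ->
    P (X @^-1` A `&` Y @^-1` B) = (P (X @^-1` A) * P (Y @^-1` B))%E) ->
  P.-integrable setT (EFin \o X) -> P.-integrable setT (EFin \o Y) ->
  P.-integrable setT (EFin \o (fun x => X x * Y x)).
Proof.
move=> mX mY indXY /integrableP[_ iX] /integrableP[_ iY].
apply/integrableP; split; first exact/measurable_EFinP/measurable_funM.
by rewrite /= ge0_integral_independentM// lte_mul_pinfty ?ge0_fin_numE ?integral_ge0.
Qed.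

(** The same identification of the joint law, with Fubini in place of Tonelli; the integrability
    that Fubini asks for comes from the absolute version. *)
Lemma Rintegral_independentM (X Y : T -> R) :
  measurable_fun setT X -> measurable_fun setT Y ->
  (forall A B, measurable A -> measurable B ->
    P (X @^-1` A `&` Y @^-1` B) = (P (X @^-1` A) * P (Y @^-1` B))%E) ->
  P.-integrable setT (EFin \o X) -> P.-integrable setT (EFin \o Y) ->
  \int[P]_x (X x * Y x) = (\int[P]_x X x) * (\int[P]_x Y x).
Proof.
move=> mX mY indXY iX iY.
have iXY := independentM_integrable mX mY indXY iX iY.
pose X' : {mfun T >-> R} := mfun_Sub (mem_set mX).
pose Y' : {mfun T >-> R} := mfun_Sub (mem_set mY).
have mXY : measurable_fun setT (fun x => (X x, Y x)).
  exact: measurable_fun_pair.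
pose XY : {mfun T >-> (R * R)%type} := mfun_Sub (mem_set mXY).
pose f (z : R * R) : \bar R := (z.1 * z.2)%:E.
have mf : measurable_fun setT f.
  apply/measurable_EFinP.
  by apply: measurable_funM; [exact: measurable_fst|exact: measurable_snd].
have lawXY C : measurable C ->
    (distribution P X' \x distribution P Y')%E C = distribution P XY C.
  by move=> mC; apply: product_measure_unique.
have if_ : (distribution P X' \x distribution P Y')%E.-integrable setT f.
  apply/integrableP; split => //.
  rewrite (@eq_measure_integral _ _ _ _ (distribution P XY)); last first.
    by move=> C mC _; exact: lawXY.
  rewrite ge0_integral_distribution//; last exact: measurableT_comp.
  by case/integrableP: iXY.
rewrite /Rintegral -(@integral_distribution _ _ _ _ _ P XY f)//.
rewrite -(@eq_measure_integral _ _ _ _ _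
    (distribution P X' \x distribution P Y')%E); last first.
  by move=> C mC _; exact: lawXY.
rewrite -integral12_prod_meas1// /fubini_F /f /=.
have iY' : (distribution P Y').-integrable setT EFin.
  by apply: (@integrable_pushforward _ _ _ _ _ Y' _ P).
have iX' : (distribution P X').-integrable setT EFin.
  by apply: (@integrable_pushforward _ _ _ _ _ X' _ P).
under eq_integral => x _.
  under eq_integral do rewrite EFinM.
  rewrite integralZl//.
  rewrite -[X in (_ * X)%E]fineK ?integrable_fin_num//.
  over.
rewrite integralZr// fineM ?integrable_fin_num//.
by rewrite !integral_distribution.
Qed.
End independence.

(** * Integrability and moments of sums and averages *)

Section integrable_averages.
Context {d : measure_display} {T : measurableType d}.
Context {R : realType} (P : probability T R).
Implicit Types (f : T -> R) (Z : nat -> T -> R) (M e : R) (n : nat).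

Lemma bounded_integrable f M : measurable_fun setT f ->
  (forall x, `|f x| <= M) -> P.-integrable setT (EFin \o f).
Proof.
move=> mf fM; apply: measurable_bounded_integrable => //.
  by rewrite /= probability_setT ltry.
exists M; split => [|r Mr x _]; first exact: num_real.
exact: le_trans (fM x) (ltW Mr).
Qed.

Lemma integrable_cstR (c : R) : P.-integrable setT (EFin \o (fun=> c)).
Proof. exact: (@bounded_integrable _ `|c|). Qed.

Lemma Rintegral_cstT (c : R) : \int[P]_x c = c.
Proof. by rewrite Rintegral_cst//= probability_setT mulr1. Qed.

Lemma integrable_measurable f :
  P.-integrable setT (EFin \o f) -> measurable_fun setT f.
Proof. by move=> /integrableP[/measurable_EFinP]. Qed.

Lemma integrableDR f g :
  P.-integrable setT (EFin \o f) -> P.-integrable setT (EFin \o g) ->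
  P.-integrable setT (EFin \o (fun x => f x + g x)).
Proof. by move=> fi gi; apply: integrableD fi gi. Qed.

Lemma integrableBR f g :
  P.-integrable setT (EFin \o f) -> P.-integrable setT (EFin \o g) ->
  P.-integrable setT (EFin \o (fun x => f x - g x)).
Proof. by move=> fi gi; apply: integrableB fi gi. Qed.

Lemma integrableZlR (c : R) f : P.-integrable setT (EFin \o f) ->
  P.-integrable setT (EFin \o (fun x => c * f x)).
Proof. by move=> fi; apply: (integrableZl measurableT c fi). Qed.

Lemma integrable_sumR Z n : (forall i, P.-integrable setT (EFin \o Z i)) ->
  P.-integrable setT (EFin \o (fun x => \sum_(i < n) Z i x)).
Proof.
move=> iZ; elim: n => [|n IHn].
  rewrite (_ : (fun x => _) = fun=> 0); first exact: integrable_cstR.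
  by apply/funext => x; rewrite big_ord0.
rewrite (_ : (fun x => _) = fun x => \sum_(i < n) Z i x + Z n x).
  exact: integrableDR.
by apply/funext => x; rewrite big_ord_recr.
Qed.

Lemma Rintegral_sum Z n : (forall i, P.-integrable setT (EFin \o Z i)) ->
  \int[P]_x (\sum_(i < n) Z i x) = \sum_(i < n) \int[P]_x Z i x.
Proof.
move=> iZ; elim: n => [|n IHn].
  under eq_Rintegral do rewrite big_ord0.
  by rewrite Rintegral_cstT big_ord0.
under eq_Rintegral do rewrite big_ord_recr /=.
by rewrite big_ord_recr /= RintegralD ?IHn//; exact: integrable_sumR.
Qed.

Lemma integrable_average Z n : (forall i, P.-integrable setT (EFin \o Z i)) ->
  P.-integrable setT (EFin \o average Z n).
Proof.
move=> iZ; rewrite (_ : average Z n = fun x => n%:R^-1 * \sum_(i < n) Z i x).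
  exact/integrableZlR/integrable_sumR.
by apply/funext => x; rewrite mulrC.
Qed.

Lemma Rintegral_average Z n (c : R) :
  (forall i, P.-integrable setT (EFin \o Z i)) ->
  (forall i, \int[P]_x Z i x = c) -> (0 < n)%N ->
  \int[P]_x average Z n x = c.
Proof.
move=> iZ Zc n0; rewrite /average RintegralZr//; last exact: integrable_sumR.
rewrite Rintegral_sum// (eq_bigr (fun=> c)) => [|i _]; last exact: Zc.
by rewrite sumr_const card_ord -[c *+ n]mulr_natr mulfK// pnatr_eq0 -lt0n.
Qed.

Lemma measurable_average Z n : (forall i, measurable_fun setT (Z i)) ->
  measurable_fun setT (average Z n).
Proof.
move=> mZ; apply: measurable_funM => //.
by apply: (@measurable_sum _ _ _ _ _ _ (fun (i : 'I_n) x => Z i x)) => i.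
Qed.

(** By induction on [n]: expanding the square of the longer sum, the cross terms integrate to 0 by
    orthogonality and the new square is at most [M ^+ 2]. *)
Lemma Rintegral_sqr_sum_le Z M n :
  (forall i, measurable_fun setT (Z i)) -> (forall i x, `|Z i x| <= M) ->
  (forall i j, i != j -> \int[P]_x (Z i x * Z j x) = 0) ->
  \int[P]_x (\sum_(i < n) Z i x) ^+ 2 <= n%:R * M ^+ 2.
Proof.
move=> mZ ZM Z0.
have iZ i : P.-integrable setT (EFin \o Z i) by exact: bounded_integrable.
have iZZ i j : P.-integrable setT (EFin \o (fun x => Z i x * Z j x)).
  apply: (@bounded_integrable _ (M * M)); first exact: measurable_funM.
  by move=> x; rewrite normrM ler_pM.
elim: n => [|n IHn].
  under eq_Rintegral do rewrite big_ord0 expr0n /=.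
  by rewrite Rintegral_cstT mul0r.
have mS k : measurable_fun setT (fun x => \sum_(i < k) Z i x).
  by apply: (@measurable_sum _ _ _ _ _ _ (fun (i : 'I_k) x => Z i x)) => i.
have iS2 : P.-integrable setT (EFin \o (fun x => (\sum_(i < n) Z i x) ^+ 2)).
  apply: (@bounded_integrable _ ((n%:R * M) ^+ 2)).
    exact: measurable_funX.
  move=> x; rewrite normrX lerXn2r ?nnegrE//.
    by rewrite mulr_ge0// (le_trans _ (ZM n x)).
  rewrite (le_trans (ler_norm_sum _ _ _))// mulr_natl -[n in M *+ n]card_ord.
  by rewrite -sumr_const ler_sum.
have iSZ : P.-integrable setT
    (EFin \o (fun x => \sum_(i < n) (2 * (Z i x * Z n x)))).
  apply: (@integrable_sumR (fun i x => 2 * (Z i x * Z n x))) => i.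
  exact: integrableZlR.
have -> : \int[P]_x (\sum_(i < n.+1) Z i x) ^+ 2 =
    \int[P]_x ((\sum_(i < n) Z i x) ^+ 2 + \sum_(i < n) (2 * (Z i x * Z n x))
      + Z n x * Z n x).
  apply: eq_Rintegral => x _; rewrite big_ord_recr /= sqrrD -mulr_sumr.
  by rewrite -mulr_suml mulr_natl expr2.
rewrite RintegralD//; last exact: integrableDR.
rewrite RintegralD// (Rintegral_sum (Z := fun i x => 2 * (Z i x * Z n x))).
  rewrite big1 => [|i _]; last first.
    by rewrite RintegralZl// Z0 ?mulr0// neq_ltn ltn_ord.
  rewrite addr0 -natr1 mulrDl mul1r lerD//.
  rewrite -[leRHS]Rintegral_cstT le_Rintegral// => [|x _].
    exact: integrable_cstR.
  by rewrite -expr2 -real_normK ?num_real// lerXn2r ?nnegrE// (le_trans _ (ZM n x)).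
by move=> i; exact: integrableZlR.
Qed.

End integrable_averages.

(** * The law of large numbers *)

Section law_of_large_numbers.
Context {d : measure_display} {T : measurableType d}.
Context {R : realType} (P : probability T R).
Implicit Types (f : T -> R) (Z : nat -> T -> R) (M e : R) (n : nat).

(** The centred variables are again i.i.d. and have mean 0, so the integral of the product of two of
    them is a product of zeros. *)
Lemma iid_Rintegral_centeredM Z i j : (forall k, measurable_fun setT (Z k)) ->
  iid P Z -> (forall k, P.-integrable setT (EFin \o Z k)) -> i != j ->
  \int[P]_x ((Z i x - \int[P]_y Z 0%N y) * (Z j x - \int[P]_y Z 0%N y)) = 0.
Proof.
move=> mZ [indZ lawZ] iZ ij; set m := \int[P]_y Z 0%N y.
have mV k : measurable_fun setT (fun x => Z k x - m) by exact: measurable_funB.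
have iV k : P.-integrable setT (EFin \o (fun x => Z k x - m)).
  by apply: integrableBR => //; exact: integrable_cstR.
have V0 k : \int[P]_x (Z k x - m) = 0.
  rewrite RintegralB//; last exact: integrable_cstR.
  by rewrite Rintegral_cstT (same_law_Rintegral (mZ k) (mZ 0%N) (lawZ k 0%N)) subrr.
rewrite Rintegral_independentM// ?V0 ?mulr0// => A B mA mB.
have [indV _] : iid P (fun k x => Z k x - m).
  exact: (iid_comp (phi := fun z : R => z - m) (measurable_funB _ _)
    (conj indZ lawZ)).
(* Independence of a pair is the case of a singleton index set. *)
have := mutually_independent_bigcap (J := [fset j]%fset) indV _ mA mB.
have -> : [set` [fset j]%fset] = [set j].
  by apply/seteqP; split => k /=; rewrite in_fset1 => /eqP.
by rewrite bigcap_set1; apply; rewrite in_fset1.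
Qed.

(** The centred sum has second moment at most [n%:R * K ^+ 2], linear in [n], while its square is
    divided by [n%:R ^+ 2]; a pointwise AM-GM bound turns this second-moment estimate into an L^1
    one. *)
Lemma bounded_lln Z M e : (forall k, measurable_fun setT (Z k)) ->
  iid P Z -> (forall k x, `|Z k x| <= M) -> 0 < e ->
  \forall n \near \oo,
    \int[P]_x `|average Z n x - \int[P]_y Z 0%N y| <= e.
Proof.
move=> mZ iidZ ZM e0; set m := \int[P]_y Z 0%N y.
have M0 : 0 <= M.
  (* The sample space is pointed, so the bound can be evaluated somewhere. *)
  by rewrite (le_trans _ (ZM 0%N point)).
have iZ k : P.-integrable setT (EFin \o Z k) by exact: bounded_integrable.
pose V k x := Z k x - m.
have mV k : measurable_fun setT (V k) by exact: measurable_funB.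
have VM k x : `|V k x| <= M + `|m|.
  by rewrite (le_trans (ler_normB _ _))// lerD2r.
have V0 i j : i != j -> \int[P]_x (V i x * V j x) = 0.
  exact: iid_Rintegral_centeredM.
set K := M + `|m| in VM.
near=> n.
have n0 : 0 < n%:R :> R by near: n; exact: nbhs_infty_gtr.
(* This threshold is what makes the quadratic term [c * (n%:R * K ^+ 2)], that is K^2 / (2 e n), at
   most [e / 2]. *)
have nK : e^-1 ^+ 2 * K ^+ 2 <= n%:R by near: n; exact: nbhs_infty_ger.
pose c := (2 * e * n%:R ^+ 2)^-1.
have c0 : 0 <= c by rewrite invr_ge0 mulr_ge0 ?sqr_ge0// mulr_ge0// ltW.
have mS : measurable_fun setT (fun x => \sum_(i < n) V i x).
  by apply: (@measurable_sum _ _ _ _ _ _ (fun (i : 'I_n) x => V i x)) => i.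
have iS : P.-integrable setT (EFin \o (fun x => (\sum_(i < n) V i x) ^+ 2)).
  apply: (@bounded_integrable _ _ _ _ _ ((n%:R * K) ^+ 2)).
    exact: measurable_funX.
  move=> x; rewrite normrX lerXn2r ?nnegrE//.
    by rewrite mulr_ge0// addr_ge0.
  rewrite (le_trans (ler_norm_sum _ _ _))// mulr_natl -[n in K *+ n]card_ord.
  by rewrite -sumr_const ler_sum.
have avgE x : average Z n x - m = (\sum_(i < n) V i x) / n%:R.
  rewrite /average /V sumrB sumr_const card_ord mulrBl -[m *+ n]mulr_natr.
  by rewrite mulfK// gt_eqF.
(* AM-GM: |a| <= e / 2 + a^2 / (2 e) *)
have amgm x : `|average Z n x - m| <= e / 2 + c * (\sum_(i < n) V i x) ^+ 2.
  rewrite avgE; set s := \sum_(i < n) _.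
  have -> : c * s ^+ 2 = (s / n%:R) ^+ 2 / (2 * e).
    by rewrite /c; field; rewrite !gt_eqF.
  rewrite -(@real_normK _ (s / n%:R)) ?num_real//; set a := `|_|.
  have : 0 <= (a - e) ^+ 2 / (2 * e).
    by rewrite mulr_ge0 ?sqr_ge0// invr_ge0 mulr_ge0// ltW.
  have -> : (a - e) ^+ 2 / (2 * e) = a ^+ 2 / (2 * e) - a + e / 2.
    by field; rewrite gt_eqF.
  by lra.
apply: (@le_trans _ _ (\int[P]_x (e / 2 + c * (\sum_(i < n) V i x) ^+ 2))).
  apply: le_Rintegral => //.
    apply: integrable_norm; apply: integrableBR; last exact: integrable_cstR.
    exact: integrable_average.
  apply: integrableDR; first exact: integrable_cstR.
  exact: integrableZlR.
rewrite RintegralD//; [|exact: integrable_cstR|exact: integrableZlR].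
rewrite Rintegral_cstT RintegralZl//.
have := ler_wpM2l c0 (Rintegral_sqr_sum_le n mV VM V0).
have cnK : c * (n%:R * K ^+ 2) <= e / 2.
  have -> : c * (n%:R * K ^+ 2) = (e^-1 ^+ 2 * K ^+ 2) / n%:R * (e / 2).
    by rewrite /c; field; rewrite !gt_eqF.
  by rewrite ler_piMl ?divr_ge0 ?(ltW e0)// ler_pdivrMr// mul1r.
by move: cnK; set u := c * _; set v := c * _; lra.
Unshelve. all: by end_near. Qed.

(** Values outside the interval are sent to 0, not clipped to the endpoints. *)
Definition truncation (M z : R) : R := z * \1_(`[- M, M]) z.

Lemma truncation_bounded M z : 0 <= M -> `|truncation M z| <= M.
Proof.
move=> M0; rewrite /truncation indicE; case: (boolP (z \in _)) => zM /=.
  by rewrite mulr1; move: zM; rewrite inE/= in_itv/= ler_norml.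
by rewrite mulr0 normr0.
Qed.

Lemma measurable_truncation M : measurable_fun setT (truncation M).
Proof. by apply: measurable_funM => //; exact: measurable_indic. Qed.

(** The truncations at integer levels converge pointwise to [f] and are dominated by its absolute
    value, so dominated convergence gives a suitable level. *)
Lemma truncation_L1 f e : P.-integrable setT (EFin \o f) -> 0 < e ->
  exists2 M, 0 <= M & \int[P]_x `|f x - truncation M (f x)| <= e.
Proof.
move=> fi e0; have mf := integrable_measurable fi.
have mtf k : measurable_fun setT (fun x => truncation k%:R (f x)).
  exact: measurableT_comp (measurable_truncation _) mf.
have [|||||_ + _] := @dominated_convergence _ _ _ P setT measurableT
  (fun k x => (truncation k%:R (f x))%:E) (EFin \o f) (fun x => `|f x|%:E).
- by move=> k; exact/measurable_EFinP.
- by move: fi => /integrableP[].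
- apply/nearW => x _; apply/cvg_ballP => r r0; near=> k.
  rewrite /truncation indicE mem_set ?mulr1; first exact: ballxx.
  by rewrite /= in_itv/= -ler_norml; near: k; exact: nbhs_infty_ger.
- exact: integrable_norm.
- apply/nearW => x k _ /=; rewrite lee_fin /truncation indicE normrM.
  by rewrite ler_piMr//; case: (_ \in _); rewrite ?normr1 ?normr0.
move/fine_cvgP => [_ /cvgrPdist_le/(_ _ e0)[N _ /(_ N (leqnn N))]].
rewrite /= sub0r normrN => He; exists N%:R => //.
apply: le_trans (le_trans (ler_norm _) He); rewrite le_eqVlt; apply/orP; left.
apply/eqP; congr fine; apply: eq_integral => x _.
by rewrite distrC.
Unshelve. all: by end_near. Qed.

(** Three errors of at most [e / 3] each: the average of the truncation errors, whose means are all
    equal by equality in law; the bounded law of large numbers for the truncated variables; the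
    difference of the two means. *)
Lemma lln Z e : iid P Z -> (forall k, P.-integrable setT (EFin \o Z k)) ->
  0 < e ->
  \forall n \near \oo,
    \int[P]_x `|average Z n x - \int[P]_y Z 0%N y| <= e.
Proof.
move=> iidZ iZ e0; have mZ k := integrable_measurable (iZ k).
have e30 : 0 < e / 3 by rewrite divr_gt0.
have [M M0 ZM] := truncation_L1 (iZ 0%N) e30.
pose V k x := truncation M (Z k x).
have mV k : measurable_fun setT (V k).
  exact: measurableT_comp (measurable_truncation _) (mZ k).
have iV k : P.-integrable setT (EFin \o V k).
  by apply: (@bounded_integrable _ _ _ _ _ M) => // x; exact: truncation_bounded.
have iD k : P.-integrable setT (EFin \o (fun x => `|Z k x - V k x|)).
  by apply: integrable_norm; exact: integrableBR.
have iidV : iid P V by exact: iid_comp (measurable_truncation M) iidZ.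
have VM k x : `|V k x| <= M by exact: truncation_bounded.
have DE k : \int[P]_x `|Z k x - V k x| = \int[P]_x `|Z 0%N x - V 0%N x|.
  apply: (@same_law_Rintegral _ _ _ _ (fun x => `|Z k x - V k x|)
    (fun x => `|Z 0%N x - V 0%N x|)).
  - exact: integrable_measurable.
  - exact: integrable_measurable.
  - have mphi : measurable_fun setT (fun z : R => `|z - truncation M z|).
      apply: measurableT_comp => //; apply: measurable_funB => //.
      exact: measurable_truncation.
    exact: same_law_comp mphi (iidZ.2 k 0%N).
set mz := \int[P]_y Z 0%N y; set mv := \int[P]_y V 0%N y.
near=> n.
have n0 : (0 < n)%N by near: n; exact: nbhs_infty_gt.
have HV : \int[P]_x `|average V n x - mv| <= e / 3.
  by near: n; exact: bounded_lln.
have Hm : `|mv - mz| <= e / 3.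
  rewrite distrC -RintegralB// (le_trans _ ZM)// le_normr_Rintegral//.
  exact: integrableBR.
have iA1 : P.-integrable setT (EFin \o average (fun k x => `|Z k x - V k x|) n).
  exact: integrable_average.
have iA2 : P.-integrable setT (EFin \o (fun x => `|average V n x - mv|)).
  apply: integrable_norm; apply: integrableBR; last exact: integrable_cstR.
  exact: integrable_average.
apply: (@le_trans _ _ (\int[P]_x (average (fun k x => `|Z k x - V k x|) n x
    + `|average V n x - mv| + `|mv - mz|))).
  apply: le_Rintegral => //.
  - apply: integrable_norm; apply: integrableBR; last exact: integrable_cstR.
    exact: integrable_average.
  - apply: integrableDR; last exact: integrable_cstR.
    exact: integrableDR.
  move=> x _; rewrite -addrA.
  have -> : average Z n x - mz =
      average (fun k x => Z k x - V k x) n x + (average V n x - mv + (mv - mz)).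
    by rewrite /average sumrB mulrBl; ring.
  rewrite (le_trans (ler_normD _ _))// lerD//; last exact: ler_normD.
  rewrite /average normrM (@ger0_norm _ _^-1) ?invr_ge0// ler_wpM2r ?invr_ge0//.
  exact: ler_norm_sum.
rewrite RintegralD//; [|exact: integrableDR|exact: integrable_cstR].
rewrite RintegralD// Rintegral_cstT (@Rintegral_average _ _ _ _ _ _ _ iD DE)//.
by move: ZM HV Hm; lra.
Unshelve. all: by end_near. Qed.

End law_of_large_numbers.

(** * Functions differentiable on an interval *)

Section intervals.
Context {R : realType}.
Implicit Types (D : set R) (g : R -> R).

(** Near [x] within [D] the difference quotient is bounded by 1 + |l|, so the increment of [g] is at
    most this constant times the distance to [x]. *)
Lemma differentiable_on_cvg D g x : differentiable_on D g -> D x ->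
  g y @[y --> within D (nbhs x)] --> g x.
Proof.
move=> dg Dx; have [l gl] := dg x Dx.
have near1 : \forall y \near x, y != x -> D y ->
    `|(g y - g x) / (y - x) - l| <= 1.
  by move/cvgrPdistC_le : gl => /(_ 1 ltr01).
have K0 : 0 < 1 + `|l| by rewrite ltr_pwDl.
apply/cvgrPdistC_le => e e0.
rewrite near_withinE; near=> y => Dy.
have [->|yx] := eqVneq y x; first by rewrite subrr normr0 ltW.
have quot : `|(g y - g x) / (y - x)| <= 1 + `|l|.
  have /(_ yx Dy) Hl : y != x -> D y -> `|(g y - g x) / (y - x) - l| <= 1.
    by near: y.
  by rewrite -lerBlDr (le_trans _ Hl)// lerB_dist.
have yxe : `|y - x| <= e / (1 + `|l|).
  have : ball x (e / (1 + `|l|)) y.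
    by near: y; apply: nbhsx_ballx; rewrite divr_gt0.
  by rewrite -ball_normE /= distrC => /ltW.
apply: (@le_trans _ _ `|(g y - g x) / (y - x) * (y - x)|).
  by rewrite divfK// subr_eq0.
rewrite normrM.
by rewrite (le_trans (ler_pM _ _ quot yxe))// mulrC divfK// gt_eqF.
Unshelve. all: by end_near. Qed.

(** An interval is a measurable set, and [g] is continuous for the subspace topology on it, hence
    measurable there. *)
Lemma measurable_comp_differentiable_on d (T : measurableType d) D g
    (f : T -> R) :
  is_interval D -> differentiable_on D g -> (forall x, D (f x)) ->
  measurable_fun setT f -> measurable_fun setT (g \o f).
Proof.
move=> iD dg Df mf; have mD := is_interval_measurable iD.
apply: (measurable_comp mD) => //; first by move=> _ [x _ <-].
apply: subspace_continuous_measurable_fun => //.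
by apply/subspace_continuousP => x Dx; exact: differentiable_on_cvg.
Qed.

(** By induction: the new average is a convex combination of the previous average and the new term,
    so it lies between two points of the interval. *)
Lemma average_interval T D (u : nat -> T -> R) n x : is_interval D ->
  (forall i, D (u i x)) -> (0 < n)%N -> D (average u n x).
Proof.
move=> iD Du; elim: n => // -[|n] IHn _.
  by rewrite /average big_ord1 divr1; exact: Du.
have {}IHn := IHn isT; set a := average u n.+1 x in IHn.
have n0 : 0 < n.+1%:R :> R by [].
have aE : average u n.+2 x = (n.+1%:R * a + u n.+1 x) / (n.+1%:R + 1).
  by rewrite /average big_ord_recr /= natr1 [_ * a]mulrC /a /average divfK.
have n1 : 0 < n.+1%:R + 1 :> R by rewrite addr_gt0.
have [au|ua] := leP a (u n.+1 x).
  apply: (iD _ _ IHn (Du n.+1)); rewrite aE ler_pdivlMr// ler_pdivrMr//.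
  by apply/andP; split; nra.
apply: (iD _ _ (Du n.+1) IHn); rewrite aE ler_pdivlMr// ler_pdivrMr//.
by apply/andP; split; nra.
Qed.

End intervals.

(** * Location of the mean, finite expectations and integrability *)

Section expectations.
Context {d : measure_display} {T : measurableType d}.
Context {R : realType} (P : probability T R).
Implicit Types (f : T -> R) (Z : nat -> T -> R) (D : set R).

(** A zero integral would make [f] vanish almost everywhere; as it vanishes nowhere, the whole space
    would be negligible. *)
Lemma Rintegral_gt0 f : P.-integrable setT (EFin \o f) ->
  (forall x, 0 < f x) -> 0 < \int[P]_x f x.
Proof.
move=> fi f0; rewrite lt_neqAle Rintegral_ge0 ?andbT => [|x _]; last exact: ltW.
apply/negP => /eqP/esym I0.
have /(ae_eq_integral_abs _ measurableT) : measurable_fun setT (EFin \o f).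
  by case/integrableP: fi.
have : (\int[P]_x `|(EFin \o f) x| = 0)%E.
  under eq_integral do rewrite /= ger0_norm ?ltW//.
  by rewrite -[LHS]fineK ?integrable_fin_num//; congr EFin.
move=> E0 /(_ P) [/(_ E0)[N [mN PN fN]] _].
have NT : N = setT.
  apply/seteqP; split => // x _; apply: fN => /= /(_ I)[fx0].
  by have := f0 x; rewrite fx0 ltxx.
by move: PN => /eqP; rewrite NT /= probability_setT onee_eq0.
Qed.

(** The mean lies between two values of [f]: otherwise the difference of [f] and its mean has a
    constant strict sign, although its integral is 0. No closedness of the interval is involved. *)
Lemma Rintegral_interval D f : is_interval D ->
  P.-integrable setT (EFin \o f) -> (forall x, D (f x)) ->
  D (\int[P]_x f x).
Proof.
move=> iD fi Df; set m := \int[P]_x f x.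
have ci := integrable_cstR P m.
have [[x fxm]|nle] := pselect (exists x, f x <= m).
  have [[y mfy]|nge] := pselect (exists y, m <= f y).
    by apply: (iD _ _ (Df x) (Df y)); rewrite fxm.
  have : 0 < \int[P]_y (m - f y).
    apply: Rintegral_gt0 => [|y]; first exact: integrableBR.
    by rewrite subr_gt0 ltNge; apply/negP => mfy; apply: nge; exists y.
  by rewrite RintegralB// Rintegral_cstT subrr ltxx.
have : 0 < \int[P]_y (f y - m).
  apply: Rintegral_gt0 => [|y]; first exact: integrableBR.
  by rewrite subr_gt0 ltNge; apply/negP => mfy; apply: nle; exists y.
by rewrite RintegralB// Rintegral_cstT subrr ltxx.
Qed.

(** In the extended reals a difference is finite only if both terms are, so the positive and the
    negative part both have finite integral. *)
Lemma expectation_fin_integrable f : measurable_fun setT f ->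
  'E_P[f]%E \is a fin_num -> P.-integrable setT (EFin \o f).
Proof.
move=> mf; rewrite unlock integralE fin_numB => /andP[fp fn].
have mEf : measurable_fun setT (EFin \o f) by exact/measurable_EFinP.
apply/integrableP; split => //.
under eq_integral do rewrite -/((abse \o (EFin \o f)) _) fune_abse.
rewrite ge0_integralD//; [|exact: measurable_funepos|exact: measurable_funeneg].
by rewrite lte_add_pinfty// -ge0_fin_numE// integral_ge0.
Qed.

Lemma expectation_Rintegral f : P.-integrable setT (EFin \o f) ->
  'E_P[f]%E = (\int[P]_x f x)%:E.
Proof. by move=> fi; rewrite unlock fineK// integrable_fin_num. Qed.

Lemma integral_independent_event f (B : set T) : measurable_fun setT f ->
  measurable B ->
  (forall A, measurable A -> P (f @^-1` A `&` B) = (P (f @^-1` A) * P B)%E) ->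
  (\int[P]_x `|f x * \1_B x|%:E = (\int[P]_x `|f x|%:E) * P B)%E.
Proof.
move=> mf mB indB; rewrite ge0_integral_independentM//.
  congr (_ * _)%E; rewrite -[in RHS](setIT B) -integral_indic//.
  by apply: eq_integral => x _; rewrite ger0_norm// indicE.
(* The preimage under the indicator is the whole space, [B], its complement or the empty set,
   according to whether [C] contains 1 and 0. *)
move=> A C mA mC; rewrite preimage_indic.
have mfA : measurable (f @^-1` A) by exact: preimage_comp_measurable.
case: ifP => _; case: ifP => _.
- by rewrite setIT probability_setT mule1.
- exact: indB.
- rewrite -setDE measureD//; last first.
    by rewrite (le_lt_trans (probability_le1 P _))// ltry.
  rewrite /= indB// probability_setC//.
  have fA : P (f @^-1` A) \is a fin_num by exact: fin_num_measure.
  by rewrite muleBr ?mule1// fin_num_adde_defr// fin_num_measure.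
- by rewrite setI0 measure0 mule0.
Qed.

(* On an event of positive probability independent of [Z 0] where the other
   summands are bounded, [Z 0] is bounded by [n * average Z n] plus a constant. *)
Lemma integrable_iid_average Z n : (forall k, measurable_fun setT (Z k)) ->
  iid P Z -> (0 < n)%N -> P.-integrable setT (EFin \o average Z n) ->
  forall k, P.-integrable setT (EFin \o Z k).
Proof.
move=> mZ [indZ lawZ]; case: n => // n _ iA k.
apply: (same_law_integrable (mZ 0%N) (mZ k) (lawZ 0%N k)).
(* The events that the absolute value of [Z 0] is at most [M] exhaust the space as [M] grows, so
   they cannot all be negligible. *)
have [M PM] : exists M : nat, P (Z 0%N @^-1` `[- M%:R, M%:R]) != 0%E.
  apply: contrapT => /forallNP PM0.
  have : P.-negligible (\bigcup_M Z 0%N @^-1` `[- (M%:R : R), M%:R]).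
    apply: negligible_bigcup => M; apply/negligibleP.
      exact: preimage_comp_measurable.
    by apply/eqP/negPn/negP; exact: PM0.
  have -> : \bigcup_M Z 0%N @^-1` `[- (M%:R : R), M%:R] = setT.
    apply/seteqP; split => // x _.
    exists (Num.bound (Z 0%N x)) => //=; rewrite in_itv/= -ler_norml.
    by rewrite ltW// unstable.ltr_norm_bound.
  by move/negligibleP => /(_ measurableT)/eqP; rewrite /= probability_setT onee_eq0.
(* The indices 1 to [n]: all the summands of the average of [n.+1] terms except the one at 0. *)
pose J := [fset i | i in iota 1 n]%fset.
pose I : set R := `[- M%:R, M%:R]%classic.
pose B := \bigcap_(j in [set` J]) (Z j @^-1` I).
have mI : measurable I by exact: measurable_itv.
have mB : measurable B.
  by apply: fin_bigcap_measurable => // j _; exact: preimage_comp_measurable.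
have PB : (0 < P B)%E.
  rewrite /B (indZ J (fun=> I))//.
  apply: (big_ind (fun y => 0 < y)%E) => //; first exact: mule_gt0.
  by move=> j _; rewrite (lawZ j 0%N)// lt_neqAle eq_sym PM measure_ge0.
have J0 : 0%N \notin J by rewrite !inE /= mem_iota.
have Zbound x : B x -> `|Z 0%N x| <= n.+1%:R * `|average Z n.+1 x| + n%:R * M%:R.
  move=> Bx; have -> : Z 0%N x =
      n.+1%:R * average Z n.+1 x - \sum_(i < n) Z i.+1 x.
    by rewrite /average mulrC divfK ?pnatr_eq0// big_ord_recl addrK.
  rewrite (le_trans (ler_normB _ _))// normrM ger0_norm// lerD2l.
  rewrite (le_trans (ler_norm_sum _ _ _))// mulr_natl -[n in _ *+ n]card_ord.
  rewrite -sumr_const ler_sum// => i _.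
  have : (Z i.+1 @^-1` I) x.
    by apply: Bx; rewrite /= !inE mem_iota /= add1n ltnS; exact: ltn_ord.
  by rewrite /I /= in_itv/= ler_norml.
apply/integrableP; split; first exact/measurable_EFinP.
have := @integral_independent_event (Z 0%N) B (mZ 0%N) mB
  (fun A mA => mutually_independent_bigcap indZ J0 mA mI).
have : (\int[P]_x `|Z 0%N x * \1_B x|%:E < +oo)%E.
  have /integrableP[_] : P.-integrable setT (EFin \o
      (fun x => n.+1%:R * `|average Z n.+1 x| + n%:R * M%:R)).
    apply: integrableDR; last exact: integrable_cstR.
    exact/integrableZlR/integrable_norm.
  apply: le_lt_trans; apply: ge0_le_integral => //.
  - apply/measurable_EFinP/measurableT_comp => //.
    by apply: measurable_funM => //; exact: measurable_indic.
  - apply/measurable_EFinP/measurableT_comp => //; apply: measurable_funD => //.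
    apply: measurable_funM => //; apply: measurableT_comp => //.
    exact: measurable_average.
  move=> x _; rewrite /= lee_fin indicE normrM [leRHS]ger0_norm; last first.
    by rewrite addr_ge0// mulr_ge0.
  case: (boolP (x \in B)) => [/set_mem/Zbound|_].
    by rewrite normr1 mulr1.
  by rewrite normr0 mulr0 addr_ge0// mulr_ge0.
(* The finite integral over [B] factors as the integral of the absolute value of [Z 0] times [P B];
   since [P B] is positive, the first factor cannot be infinite. *)
move=> + ZB; rewrite ZB; set E := (\int[P]_x _)%E.
rewrite [E](_ : _ = \int[P]_x `|(EFin \o Z 0%N) x|)%E//.
case: (\int[P]_x `|(EFin \o Z 0%N) x|)%E => [r _|/=|//].
  by rewrite ltry.
by rewrite gt0_mulye.
Qed.

End expectations.

(** * Asymptotic uniform integrability *)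

Section uniform_integrability.
Context {d : measure_display} {T : measurableType d}.
Context {R : realType} (P : probability T R).
Implicit Types (f : T -> R) (U Z : nat -> T -> R) (D : set R) (g : R -> R).

Lemma integral_tail f (M : R) : measurable_fun setT f ->
  (\int[P]_(x in [set x | (M < `|f x|)%R]) (`|f x|)%:E =
   \int[P]_x (`|f x| * \1_[set y | (M < `|f y|)%R] x)%:E)%E.
Proof.
move=> mf; rewrite integral_mkcond; apply: eq_integral => x _.
rewrite patchE indicE; case: (x \in _); first by rewrite mulr1.
by rewrite mulr0.
Qed.

Lemma measurable_tail f (M : R) : measurable_fun setT f ->
  measurable [set x | M < `|f x|].
Proof.
move=> mf; rewrite -[X in measurable X]setTI.
have /(_ measurableT `]M, +oo[%classic) : measurable_fun setT (fun x => `|f x|).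
  exact: measurableT_comp.
have -> : (fun x => `|f x|) @^-1` `]M, +oo[%classic = [set x | M < `|f x|].
  by apply/seteqP; split => x /=; rewrite in_itv/= andbT.
by apply; exact: measurable_itv.
Qed.

(** The level enters through its absolute value because its sign is unconstrained. *)
Lemma le_tail_normr f (M : R) x :
  `|f x| <= `|M| + `|f x| * \1_[set y | M < `|f y|] x.
Proof.
rewrite indicE; case: (boolP (x \in _)) => [_|]; first by rewrite mulr1 lerDr.
rewrite notin_setE /= => /negP; rewrite -leNgt mulr0 addr0 => fM.
exact: le_trans fM (ler_norm _).
Qed.

Lemma integrable_finite_tail f (M : R) : measurable_fun setT f ->
  (\int[P]_(x in [set x | (M < `|f x|)%R]) (`|f x|)%:E < +oo)%E ->
  P.-integrable setT (EFin \o f).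
Proof.
move=> mf; rewrite integral_tail// => tf.
have mt : measurable_fun setT (fun x => `|f x| * \1_[set y | M < `|f y|] x).
  apply: measurable_funM; first exact: measurableT_comp.
  exact/measurable_indic/measurable_tail.
have t0 x : 0 <= `|f x| * \1_[set y | M < `|f y|] x by rewrite mulr_ge0.
have ti : P.-integrable setT
    (EFin \o (fun x => `|f x| * \1_[set y | M < `|f y|] x)).
  apply/integrableP; split; first exact/measurable_EFinP.
  by under eq_integral do rewrite /= ger0_norm//.
apply: (le_integrable _ _ _ (integrableDR (integrable_cstR P `|M|) ti)) => //.
  exact/measurable_EFinP.
move=> x _; rewrite /= lee_fin [leRHS]ger0_norm ?addr_ge0//.
exact: le_tail_normr.
Qed.

(** A single tolerance, here 1, is enough: a variable with a finite tail integral is integrable. *)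
Lemma aui_integrable U : asymptotically_uniformly_integrable P U ->
  (\forall k \near \oo, measurable_fun setT (U k)) ->
  \forall k \near \oo, P.-integrable setT (EFin \o U k).
Proof.
move=> /(_ 1 ltr01)[M UM] mU; near=> k.
apply: (@integrable_finite_tail _ M); first by near: k.
rewrite (@le_lt_trans _ _ 1%:E) ?ltry//.
by near: k.
Unshelve. all: by end_near. Qed.

Lemma integrable_indicR f (A : set T) : measurable A ->
  P.-integrable setT (EFin \o f) ->
  P.-integrable setT (EFin \o (fun x => f x * \1_A x)).
Proof.
move=> mA fi; apply: (le_integrable _ _ _ fi) => //.
  apply/measurable_EFinP/measurable_funM; first exact: integrable_measurable fi.
  exact: measurable_indic.
move=> x _; rewrite /= lee_fin normrM ler_piMr// indicE.
by case: (_ \in _); rewrite ?normr1 ?normr0.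
Qed.

(* Vitali: |u - c| <= e/3 + |u| [|u| > M] + (|M| + |c|) [|u - c| > e/3]. *)
Lemma aui_expectation_cvg U (c : R) : asymptotically_uniformly_integrable P U ->
  (\forall k \near \oo, measurable_fun setT (U k)) ->
  (forall e r : R, 0 < e -> 0 < r -> \forall k \near \oo,
    (P [set x | (e < `|U k x - c|)%R] <= r%:E)%E) ->
  ('E_P[U k] @[k --> \oo] --> c%:E)%E.
Proof.
move=> auiU mU probU; have iU := aui_integrable auiU mU.
suff : \int[P]_x U k x @[k --> \oo] --> c.
  move=> Uc; apply/fine_cvgP; split.
    by near=> k; rewrite expectation_Rintegral//; near: k.
  apply: cvg_trans Uc; apply: near_eq_cvg; near=> k.
  by rewrite /= expectation_Rintegral//; near: k.
apply/cvgrPdistC_le => e e0.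
have e30 : 0 < e / 3 by rewrite divr_gt0.
have [M UM] := auiU _ e30.
pose K := `|M| + `|c|.
have K1 : 0 < K + 1 by rewrite ltr_wpDl// addr_ge0.
(* Dividing by [K + 1] keeps the quotient positive when [K] is 0, and still gives K P(B) at most e /
   3. *)
have r0 : 0 < e / 3 / (K + 1) by rewrite divr_gt0.
near=> k.
have Uki : P.-integrable setT (EFin \o U k) by near: k.
have mUk := integrable_measurable Uki.
have PB : (P [set x | (e / 3 < `|U k x - c|)%R] <= (e / 3 / (K + 1))%:E)%E.
  by near: k; exact: probU.
pose A := [set x | M < `|U k x|].
pose B := [set x | e / 3 < `|U k x - c|].
have mA : measurable A by exact: measurable_tail.
have mB : measurable B.
  by apply: (@measurable_tail (fun x => U k x - c)); exact: measurable_funB.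
have ti : P.-integrable setT (EFin \o (fun x => `|U k x| * \1_A x)).
  by apply: integrable_indicR => //; exact: integrable_norm.
have UcE : P.-integrable setT (EFin \o (fun x => U k x - c)).
  by apply: integrableBR => //; exact: integrable_cstR.
have iB : P.-integrable setT (EFin \o (fun x => K * \1_B x)).
  exact: (integrable_indicR mB (integrable_cstR P K)).
have tail : \int[P]_x (`|U k x| * \1_A x) <= e / 3.
  rewrite -lee_fin fineK ?integrable_fin_num// -integral_tail//.
  by near: k.
have probB : \int[P]_x (K * \1_B x) <= e / 3.
  rewrite RintegralZl//; last exact: integrable_indic.
  rewrite /Rintegral integral_indic// setIT.
  have : fine (P B) <= e / 3 / (K + 1).
    rewrite -lee_fin fineK ?fin_num_measure//.
  rewrite ler_pdivlMr// mulrDr mulr1 mulrC.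
  have : 0 <= fine (P B) by rewrite fine_ge0.
  lra.
have -> : \int[P]_x U k x - c = \int[P]_x (U k x - c).
  by rewrite RintegralB ?Rintegral_cstT//; exact: integrable_cstR.
apply: (le_trans (le_normr_Rintegral _ _)) => //.
apply: (@le_trans _ _ (\int[P]_x (e / 3 + `|U k x| * \1_A x + K * \1_B x))).
  apply: le_Rintegral => //; first exact: integrable_norm.
    by apply: integrableDR => //; apply: integrableDR => //; exact: integrable_cstR.
  move=> x _; rewrite [\1_B x]indicE; case: (boolP (x \in B)) => [_|].
    rewrite mulr1 (le_trans (ler_normB _ _))//.
    by have := le_tail_normr (U k) M x; rewrite -/A /K; lra.
  rewrite notin_setE /B /= => /negP; rewrite -leNgt mulr0 addr0 => Uce.
  by rewrite (le_trans Uce)// lerDl mulr_ge0.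
rewrite RintegralD//; last first.
  by apply: integrableDR => //; exact: integrable_cstR.
rewrite RintegralD ?Rintegral_cstT//; last exact: integrable_cstR.
lra.
Unshelve. all: by end_near. Qed.

(** An empty average is 0, which may lie outside [D]; hence the positivity of [n]. *)
Lemma measurable_comp_average D g Z n : is_interval D ->
  differentiable_on D g -> (forall i x, D (Z i x)) ->
  (forall i, measurable_fun setT (Z i)) -> (0 < n)%N ->
  measurable_fun setT (g \o average Z n).
Proof.
move=> iD dg DZ mZ n0; apply: (measurable_comp_differentiable_on iD dg).
  by move=> x; exact: average_interval.
exact: measurable_average.
Qed.

Lemma measurable_comp_average_near D g Z (N : nat -> nat) : is_interval D ->
  differentiable_on D g -> (forall i x, D (Z i x)) ->
  (forall i, measurable_fun setT (Z i)) -> N k @[k --> \oo] --> \oo ->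
  \forall k \near \oo, measurable_fun setT (g \o average Z (N k)).
Proof.
move=> iD dg DZ mZ NN; near=> k.
apply: (measurable_comp_average iD dg) => //.
by near: k; exact: (NN _ (nbhs_infty_gt 0)).
Unshelve. all: by end_near. Qed.

(** Continuity of [g] at the mean, within [D], and Markov's inequality applied to the L^1 law of
    large numbers give the convergence in probability that the Vitali-type criterion requires. *)
Lemma aui_average_cvg D g Z (N : nat -> nat) : is_interval D ->
  differentiable_on D g -> (forall i x, D (Z i x)) -> iid P Z ->
  (forall i, P.-integrable setT (EFin \o Z i)) -> N k @[k --> \oo] --> \oo ->
  asymptotically_uniformly_integrable P (fun k => g \o average Z (N k)) ->
  ('E_P[g \o average Z (N k)] @[k --> \oo] --> (g (\int[P]_x Z 0%N x))%:E)%E.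
Proof.
move=> iD dg DZ iidZ iZ NN auiU.
have mZ i := integrable_measurable (iZ i).
have Dm : D (\int[P]_x Z 0%N x) by exact: Rintegral_interval.
set m := \int[P]_x Z 0%N x in Dm *.
apply: aui_expectation_cvg => //; first exact: (measurable_comp_average_near iD dg).
move=> e r e0 r0.
have /cvgrPdistC_le/(_ _ e0) := differentiable_on_cvg dg Dm.
rewrite near_withinE => /nbhs_ballP[del /= del0 gdel].
near=> k.
have N0 : (0 < N k)%N by near: k; exact: (NN _ (nbhs_infty_gt 0)).
(* The bound [r * del] is chosen so that Markov's inequality at distance [del] yields probability at
   most [r]. *)
have L1 : \int[P]_x `|average Z (N k) x - m| <= r * del.
  by near: k; apply: (NN _ (lln iidZ iZ _)); rewrite mulr_gt0.
set B := [set x | _].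
have mB : measurable B.
  apply: (@measurable_tail (fun x => g (average Z (N k) x) - g m)).
  by apply: measurable_funB => //; exact: (measurable_comp_average iD dg).
rewrite -[P B]fineK ?fin_num_measure// lee_fin -(ler_pM2r del0).
apply: le_trans L1; rewrite mulrC -[in leLHS](setIT B) -integral_indic//.
rewrite -/(Rintegral P setT \1_B) -RintegralZl//; last exact: integrable_indic.
have iA : P.-integrable setT (EFin \o (fun x => `|average Z (N k) x - m|)).
  apply: integrable_norm; apply: integrableBR; last exact: integrable_cstR.
  exact: integrable_average.
apply: le_Rintegral => //.
  exact: (integrable_indicR mB (integrable_cstR P del)).
(* On [B] the value of [g] has moved by more than [e], so the average is at distance at least [del]
   from [m]. *)
move=> x _; case: (boolP (x \in B)) => [/set_mem|_]; last first.
  by rewrite mulr0.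
rewrite mulr1 /B /= => eg; rewrite leNgt; apply/negP => Zdel.
move: eg; rewrite ltNge => /negP; apply; apply: gdel.
  by rewrite -ball_normE /= distrC.
exact: average_interval.
Unshelve. all: by end_near. Qed.

Lemma expectation_average Z n : (forall i, P.-integrable setT (EFin \o Z i)) ->
  (forall i j, same_law P (Z i) (Z j)) -> (0 < n)%N ->
  ('E_P[average Z n] = (\int[P]_x Z 0%N x)%:E)%E.
Proof.
move=> iZ lawZ n0; have mZ i := integrable_measurable (iZ i).
rewrite expectation_Rintegral; last exact: integrable_average.
by congr EFin; apply: Rintegral_average => // i; exact: same_law_Rintegral.
Qed.

(** A finite limit makes the difference eventually finite, which forces both terms to be finite. *)
Lemma expectations_merge_near_fin_num (A B : nat -> T -> R) :
  expectations_merge P A B ->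
  \forall k \near \oo, 'E_P[A k]%E \is a fin_num /\ 'E_P[B k]%E \is a fin_num.
Proof.
move=> /fine_cvgP[+ _]; apply: filterS => k.
by rewrite fin_numB => /andP.
Qed.

Lemma expectations_merge_average D g Z Z' (N N' : nat -> nat) :
  is_interval D -> differentiable_on D g ->
  (forall i, measurable_fun setT (Z i)) ->
  (forall i, measurable_fun setT (Z' i)) ->
  (forall i x, D (Z i x)) -> (forall i x, D (Z' i x)) ->
  iid P Z -> iid P Z' ->
  N k @[k --> \oo] --> \oo -> N' k @[k --> \oo] --> \oo ->
  asymptotically_uniformly_integrable P (fun k => g \o average Z (N k)) ->
  asymptotically_uniformly_integrable P (fun k => g \o average Z' (N' k)) ->
  expectations_merge P (fun k => average Z (N k)) (fun k => average Z' (N' k)) ->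
  expectations_merge P (fun k => g \o average Z (N k))
    (fun k => g \o average Z' (N' k)).
Proof.
move=> iD dg mZ mZ' DZ DZ' iidZ iidZ' NN NN' aui aui' mrg.
have N0 := NN _ (nbhs_infty_gt 0); have N0' := NN' _ (nbhs_infty_gt 0).
have [iZ iZ'] : (forall i, P.-integrable setT (EFin \o Z i)) /\
    (forall i, P.-integrable setT (EFin \o Z' i)).
  (* One sufficiently late index gives integrability of every summand. *)
  near \oo => k.
  have [] : 'E_P[average Z (N k)]%E \is a fin_num /\
      'E_P[average Z' (N' k)]%E \is a fin_num.
    by near: k; exact: expectations_merge_near_fin_num mrg.
  move=> /(expectation_fin_integrable (measurable_average _ mZ)) iA.
  move=> /(expectation_fin_integrable (measurable_average _ mZ')) iA'.
  split.
    by apply: (integrable_iid_average mZ iidZ _ iA); near: k.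
  by apply: (integrable_iid_average mZ' iidZ' _ iA'); near: k.
have mm : \int[P]_x Z 0%N x = \int[P]_x Z' 0%N x.
  apply/eqP; rewrite -subr_eq0; apply/eqP.
  (* For nonempty averages the expectations are exactly the two means, so the merging sequence is
     eventually constant and its value must be the limit 0. *)
  suff : ((\int[P]_x Z 0%N x - \int[P]_x Z' 0%N x)%:E) @[k --> \oo] --> 0%E.
    move=> m0; apply: EFin_inj.
    exact: (cvg_unique (@ereal_hausdorff R) (cvg_cst _) m0).
  apply: cvg_trans mrg; apply: near_eq_cvg; near=> k.
  rewrite !expectation_average ?EFinB//.
  - exact: iidZ'.2.
  - by near: k.
  - exact: iidZ.2.
  - by near: k.
rewrite /expectations_merge -[0%E](@subee _ (g (\int[P]_x Z 0%N x))%:E)//.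
apply: cvgeB => //; first exact: (aui_average_cvg iD dg).
by rewrite mm; exact: (aui_average_cvg iD dg).
Unshelve. all: by end_near. Qed.

Lemma asymptotically_unbiased_integrable U (tau : R) :
  (\forall k \near \oo, measurable_fun setT (U k)) ->
  asymptotically_unbiased P U tau ->
  \forall k \near \oo, P.-integrable setT (EFin \o U k).
Proof.
move=> mU /fine_cvgP[fU _]; near=> k.
by apply: expectation_fin_integrable; near: k.
Unshelve. all: by end_near. Qed.

Lemma expectationBR f1 f2 : P.-integrable setT (EFin \o f1) ->
  P.-integrable setT (EFin \o f2) ->
  ('E_P[fun x => (f1 x - f2 x)%R] = 'E_P[f1] - 'E_P[f2])%E.
Proof.
move=> i1 i2.
by rewrite (expectationB (X := f1) (Y := f2))//; exact/Lfun1_integrable.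
Qed.

(** Eventual integrability lets linearity of the expectation be used for all large [k]; the limit is
    then taken term by term. *)
Lemma asymptotically_unbiased_lincomb U V (s t a b : R) :
  (\forall k \near \oo, P.-integrable setT (EFin \o U k)) ->
  (\forall k \near \oo, P.-integrable setT (EFin \o V k)) ->
  asymptotically_unbiased P U s -> asymptotically_unbiased P V t ->
  asymptotically_unbiased P (fun k x => a * U k x + b * V k x) (a * s + b * t).
Proof.
move=> iU iV Us Vt.
have {Us Vt} : ((a%:E * 'E_P[U k] + b%:E * 'E_P[V k])%E @[k --> \oo]
    --> (a%:E * s%:E + b%:E * t%:E)%E).
  by apply: cvgeD => //; apply: cvgeZl.
rewrite /asymptotically_unbiased EFinD !EFinM; apply: cvg_trans.
apply: near_eq_cvg; near=> k.
have Uk : P.-integrable setT (EFin \o U k) by near: k.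
have Vk : P.-integrable setT (EFin \o V k) by near: k.
by rewrite !expectation_Rintegral ?RintegralD ?RintegralZl ?EFinD ?EFinM//;
   do ?apply: integrableDR; do ?exact: integrableZlR.
Unshelve. all: by end_near. Qed.

End uniform_integrability.

(** * Adjusted estimators as linear combinations *)

Section adjusted_estimators.
Context {d : measure_display} {T : measurableType d}.
Context {R : realType} (P : probability T R).
Implicit Types (U A B : nat -> T -> R) (tau theta : R).

Lemma expectations_merge_unbiased A B :
  (\forall k \near \oo, measurable_fun setT (A k)) ->
  (\forall k \near \oo, measurable_fun setT (B k)) ->
  expectations_merge P A B ->
  (\forall k \near \oo, P.-integrable setT (EFin \o (fun x => A k x - B k x))) /\
  asymptotically_unbiased P (fun k x => A k x - B k x) 0.
Proof.
move=> mA mB AB; have fAB := expectations_merge_near_fin_num AB.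
have iA : \forall k \near \oo, P.-integrable setT (EFin \o A k).
  near=> k; apply: expectation_fin_integrable; first by near: k.
  by near: k; apply: filterS fAB => k [].
have iB : \forall k \near \oo, P.-integrable setT (EFin \o B k).
  near=> k; apply: expectation_fin_integrable; first by near: k.
  by near: k; apply: filterS fAB => k [].
split; first by near=> k; apply: integrableBR; near: k.
apply: cvg_trans AB; apply: near_eq_cvg; near=> k.
by rewrite expectationBR//; near: k.
Unshelve. all: by end_near. Qed.

(** A combination with coefficients 1 and [- theta] of sequences whose expectations tend to [tau]
    and 0. *)
Lemma asymptotically_unbiased_adjust U A B tau theta :
  (\forall k \near \oo, P.-integrable setT (EFin \o U k)) ->
  asymptotically_unbiased P U tau ->
  (\forall k \near \oo, measurable_fun setT (A k)) ->
  (\forall k \near \oo, measurable_fun setT (B k)) ->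
  expectations_merge P A B ->
  asymptotically_unbiased P (fun k x => U k x - theta * (A k x - B k x)) tau.
Proof.
move=> iU Utau mA mB /(expectations_merge_unbiased mA mB)[iAB AB0].
have := asymptotically_unbiased_lincomb (a := 1) (b := - theta) iU iAB Utau AB0.
rewrite mulr0 addr0 mul1r; congr (asymptotically_unbiased P _ _).
by apply/funext => k; apply/funext => x; rewrite mul1r mulNr.
Qed.

Lemma asymptotically_unbiased_combination U A tau (a b : R) : a + b = 1 ->
  (\forall k \near \oo, P.-integrable setT (EFin \o U k)) ->
  (\forall k \near \oo, P.-integrable setT (EFin \o A k)) ->
  asymptotically_unbiased P U tau -> asymptotically_unbiased P A tau ->
  asymptotically_unbiased P (fun k x => a * U k x + b * A k x) tau.
Proof.
move=> ab iU iA Utau Atau.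
have := asymptotically_unbiased_lincomb (a := a) (b := b) iU iA Utau Atau.
by rewrite -mulrDl ab mul1r.
Qed.

End adjusted_estimators.

(* Arms and treatment levels are booleans: true = treatment, false = control.
   X w i and Y w i a are the predictors and the response under treatment level
   a of the i-th unit of arm w; its observed response is Y w i w.  Ypop a is the
   response Y(a) of a generic unit.  The k-th experiment uses the first Nt k
   treated and the first Nc k control units. *)
Theorem lemma3p1 (R : realType) (d : measure_display) (T : measurableType d)
    (P : probability T R) (p : nat)
    (X : bool -> nat -> {RV P >-> p.-tuple R})
    (Y : bool -> nat -> bool -> {RV P >-> R})
    (Ypop : bool -> {RV P >-> R})
    (D : set R) (g : R -> R)
    (h : p.-tuple R -> bool -> R) (f : p.-tuple R -> R)
    (Nt Nc : nat -> nat) (theta gamma1 gamma2 : R)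
    (* the units of each arm are a random sample *)
    (Hiid : forall w : bool,
       iid P (fun i x => (X w i x, (Y w i false x, Y w i true x))))
    (Hpop : forall (w : bool) (i : nat) (a : bool),
       same_law P (Y w i a) (Ypop a))
    (Hint : forall a : bool, P.-integrable setT (EFin \o Ypop a))
    (* h and f are functions of the predictors, measurable so that h(X_i, w)
       and f(X_i) are random variables *)
    (Hh : forall w : bool, measurable_fun setT (h^~ w))
    (Hf : measurable_fun setT f)
    (* g is differentiable, on an interval containing all its arguments *)
    (HD : is_interval D)
    (HDY : forall w i a x, D (Y w i a x))
    (HDh : forall w i w' x, D (h (X w i x) w'))
    (HDf : forall w i x, D (f (X w i x)))
    (Hg : differentiable_on D g)
    (HNt : Nt k @[k --> \oo] --> \oo)
    (HNc : Nc k @[k --> \oo] --> \oo)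
    (Hgamma : gamma1 + gamma2 = 1) :
  let Yt k := average (fun i => Y true i true) (Nt k) in
  let Yc k := average (fun i => Y false i false) (Nc k) in
  let ht w k := average (fun i x => h (X true i x) w) (Nt k) in
  let hc w k := average (fun i x => h (X false i x) w) (Nc k) in
  let ft k := average (fun i x => f (X true i x)) (Nt k) in
  let fc k := average (fun i x => f (X false i x)) (Nc k) in
  let AUI := asymptotically_uniformly_integrable P in
  let tau := g (fine 'E_P[Ypop true]%E) - g (fine 'E_P[Ypop false]%E) in
  let tauhat k := fun x => g (Yt k x) - g (Yc k x) in
  AUI (fun k => g \o Yt k) -> AUI (fun k => g \o Yc k) ->
  [/\ (* the unadjusted estimator *)
      asymptotically_unbiased P tauhat tau
      /\ ((forall x, g x = x) ->
          forall k, (0 < Nt k)%N -> (0 < Nc k)%N -> 'E_P[tauhat k]%E = tau%:E),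
      (* (a) *)
      forall w : bool,
        (expectations_merge P (fun k => g \o ht w k) (fun k => g \o hc w k) ->
         asymptotically_unbiased P
           (fun k x => tauhat k x - theta * (g (ht w k x) - g (hc w k x))) tau)
        /\ (AUI (fun k => g \o ht w k) -> AUI (fun k => g \o hc w k) ->
            expectations_merge P (ht w) (hc w) ->
            expectations_merge P (fun k => g \o ht w k) (fun k => g \o hc w k)),
      (* (b) *)
      (expectations_merge P (fun k => g \o ft k) (fun k => g \o fc k) ->
       asymptotically_unbiased P
         (fun k x => tauhat k x - theta * (g (ft k x) - g (fc k x))) tau)
      /\ (AUI (fun k => g \o ft k) -> AUI (fun k => g \o fc k) ->
          expectations_merge P ft fc ->
          expectations_merge P (fun k => g \o ft k) (fun k => g \o fc k)),
      (* (c) *)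
      asymptotically_unbiased P
        (fun k x => g (hc true k x) - g (ht false k x)) tau ->
      asymptotically_unbiased P
        (fun k x => gamma1 * tauhat k x
                    + gamma2 * (g (hc true k x) - g (ht false k x))) tau
    & (* (d) *)
      asymptotically_unbiased P
        (fun k x => g (Yt k x) - g (hc false k x)) tau ->
      asymptotically_unbiased P
        (fun k x => g (ht true k x) - g (Yc k x)) tau ->
      asymptotically_unbiased P
        (fun k x => gamma1 * (g (Yt k x) - g (hc false k x))
                    + gamma2 * (g (ht true k x) - g (Yc k x))) tau].
Proof.
move=> Yt Yc ht hc ft fc AUI tau tauhat auiYt auiYc.
(* The i.i.d. hypothesis concerns the triples of predictors and both potential responses; measurable
   projections carry it over to each component. *)
have mYw (a : bool) : measurable_fun setT
    (fun z : p.-tuple R * (R * R) => if a then z.2.2 else z.2.1).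
  case: a; first exact: measurableT_comp measurable_snd measurable_snd.
  exact: measurableT_comp measurable_fst measurable_snd.
have iidY w a : iid P (fun i => Y w i a : T -> R).
  by have := iid_comp (mYw a) (Hiid w); case: a.
have iidX w (phi : p.-tuple R -> R) : measurable_fun setT phi ->
    iid P (fun i x => phi (X w i x)).
  move=> mphi; apply: (iid_comp (phi := phi \o fst) _ (Hiid w)).
  exact: measurableT_comp.
have mX w (phi : p.-tuple R -> R) i : measurable_fun setT phi ->
    measurable_fun setT (fun x => phi (X w i x)).
  by move=> mphi; exact: measurableT_comp.
have iY w i a : P.-integrable setT (EFin \o Y w i a).
  exact: same_law_integrable (same_law_sym (Hpop w i a)) (Hint a).
have EY w i a : \int[P]_x Y w i a x = fine 'E_P[Ypop a].
  by rewrite unlock; exact: same_law_Rintegral.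
have mtYt : \forall k \near \oo, measurable_fun setT (g \o Yt k).
  exact: (measurable_comp_average_near HD Hg).
have mtYc : \forall k \near \oo, measurable_fun setT (g \o Yc k).
  exact: (measurable_comp_average_near HD Hg).
have mht w : \forall k \near \oo, measurable_fun setT (g \o ht w k).
  by apply: (measurable_comp_average_near HD Hg) => // i; exact: (mX true (h^~ w)).
have mhc w : \forall k \near \oo, measurable_fun setT (g \o hc w k).
  by apply: (measurable_comp_average_near HD Hg) => // i; exact: (mX false (h^~ w)).
have mft : \forall k \near \oo, measurable_fun setT (g \o ft k).
  by apply: (measurable_comp_average_near HD Hg) => // i; exact: (mX true f).
have mfc : \forall k \near \oo, measurable_fun setT (g \o fc k).
  by apply: (measurable_comp_average_near HD Hg) => // i; exact: (mX false f).
have iYt := aui_integrable auiYt mtYt.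
have iYc := aui_integrable auiYc mtYc.
have itau : \forall k \near \oo, P.-integrable setT (EFin \o tauhat k).
  by near=> k; apply: (integrableBR (f := g \o Yt k) (g := g \o Yc k)); near: k.
have tauhat_unbiased : asymptotically_unbiased P tauhat tau.
  have Et := aui_average_cvg HD Hg (fun i => HDY true i true)
    (iidY true true) (fun i => iY true i true) HNt auiYt.
  have Ec := aui_average_cvg HD Hg (fun i => HDY false i false)
    (iidY false false) (fun i => iY false i false) HNc auiYc.
  (* The limits, computed at the mean of the first unit of each arm, become values of [g] at the
     population means. *)
  rewrite !EY in Et Ec.
  have := asymptotically_unbiased_lincomb (a := 1) (b := -1) iYt iYc Et Ec.
  rewrite mul1r mulN1r; congr (asymptotically_unbiased P _ _).
  by apply/funext => k; apply/funext => x; rewrite mul1r mulN1r.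
have mdiff (A B : nat -> T -> R) :
    (\forall k \near \oo, measurable_fun setT (g \o A k)) ->
    (\forall k \near \oo, measurable_fun setT (g \o B k)) ->
    \forall k \near \oo, measurable_fun setT (fun x => g (A k x) - g (B k x)).
  move=> mA mB; near=> k.
  by apply: (measurable_funB (f := g \o A k) (g := g \o B k)); near: k.
split.
(* For the identity, linearity gives the exact expectation at each [k] with both arms nonempty. *)
- split=> // gid k Nt0 Nc0.
  have -> : tauhat k = fun x => Yt k x - Yc k x.
    by apply/funext => x; rewrite /tauhat !gid.
  rewrite expectationBR; try exact: integrable_average.
  rewrite (expectation_average (fun i => iY true i true) (iidY true true).2)//.
  rewrite (expectation_average (fun i => iY false i false) (iidY false false).2)//.
  by rewrite /tau !gid !EY.
- move=> w; split=> [|auit auic].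
    exact: asymptotically_unbiased_adjust.
  apply: (expectations_merge_average HD Hg) => // [i|i||].
  + exact: (mX true (h^~ w)).
  + exact: (mX false (h^~ w)).
  + exact: (iidX true (h^~ w)).
  + exact: (iidX false (h^~ w)).
- split=> [|auit auic].
    exact: asymptotically_unbiased_adjust.
  apply: (expectations_merge_average HD Hg) => // [i|i||].
  + exact: (mX true f).
  + exact: (mX false f).
  + exact: iidX.
  + exact: iidX.
(* The assumed finite limit itself supplies the eventual integrability of the imputed difference;
   the same device serves both differences in (d). *)
- move=> diff_unbiased; apply: asymptotically_unbiased_combination => //.
  by apply: asymptotically_unbiased_integrable diff_unbiased; exact: mdiff.
- move=> unbiased0 unbiased1; apply: asymptotically_unbiased_combination => //.
    by apply: asymptotically_unbiased_integrable unbiased0; exact: mdiff.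
  by apply: asymptotically_unbiased_integrable unbiased1; exact: mdiff.
Unshelve. all: by end_near. Qed.
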